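(* Let $H$ be the graph on vertex set $\{0,1,2,3\}$ with red edge set $\{\{0,2\}\}$ and blue edge set $\{\{0,1\},\{0,3\},\{1,3\}\}$. For every $\varepsilon>0$ there are $\delta>0$ and $n_0$ such that every graph $G$ with $n\ge n_0$ vertices that satisfies $\lambda_H(G)\ge 1/8-\delta$ is within edit distance at most $\varepsilon n^2$ from the complete bipartite graph with parts of sizes $\lfloor n/2\rfloor$ and $\lceil n/2\rceil$.
   Context: All graphs are finite and simple. For a graph $H$ with $\kappa$ vertices whose edges are coloured red or blue and an uncoloured graph $G$ with $n\ge\kappa$ vertices, an embedding of $H$ into $G$ is an injection $V(H)\to V(G)$ that maps red edges of $H$ to edges of $G$ and blue edges of $H$ to non-edges of $G$ (pairs of distinct non-adjacent vertices). $\Lambda_H(G)$ is the number of embeddings and $\lambda_H(G):=\Lambda_H(G)/\big(n(n-1)\cdots(n-\kappa+1)\big)$. The edit distance between two graphs $G,G'$ with the same number of vertices is the minimum of $|f(E(G))\bigtriangleup E(G')|$ over all bijections $f:V(G)\to V(G')$. *)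

(* Defs.v *)
From mathcomp Require Import all_boot all_order all_algebra.
From mathcomp Require Import reals.

Set Implicit Arguments.
Unset Strict Implicit.
Unset Printing Implicit Defensive.

Import Order.TTheory GRing.Theory Num.Theory.

(* A simple graph is given by its edge set, a set of 2-element vertex sets. *)
Record sgraph (V : finType) := SGraph {
  edges : {set {set V}};
  edges_card2 : [forall e in edges, #|e| == 2] }.

Definition nonedges (V : finType) (G : sgraph V) : {set {set V}} :=
  [set e : {set V} | (#|e| == 2) && (e \notin edges G)].

(* A graph with red and blue edges; a pair that is neither is not an edge and
   is left unconstrained by embeddings. *)
Record cgraph (W : finType) := CGraph {
  red : sgraph W;
  blue : sgraph W;
  red_blue_disjoint : [disjoint edges red & edges blue] }.

Definition embedding (W V : finType) (H : cgraph W) (G : sgraph V)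
    (f : {ffun W -> V}) : bool :=
  [&& injectiveb f,
      [forall e in edges (red H), f @: e \in edges G]
    & [forall e in edges (blue H), f @: e \in nonedges G]].

Definition Lambda (W V : finType) (H : cgraph W) (G : sgraph V) : nat :=
  #|[set f : {ffun W -> V} | embedding H G f]|.

(* n ^_ k is n (n - 1) ... (n - k + 1); it vanishes for #|V| < #|W|, where the
   density is 0 by the convention x / 0 = 0. *)
Definition lambda (R : realType) (W V : finType) (H : cgraph W) (G : sgraph V)
    : R :=
  ((Lambda H G)%:R / (#|V| ^_ #|W|)%:R)%R.

Definition bijectiveb (V V' : finType) (f : {ffun V -> V'}) : bool :=
  injectiveb f && [forall y, y \in codom f].

Lemma bijectiveP (V V' : finType) (f : {ffun V -> V'}) :
  reflect (bijective f) (bijectiveb f).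
Proof.
apply: (iffP andP) => [[/injectiveP fI /forallP fS]|[g fK gK]].
  exists (fun y => iinv (fS y)) => [x|y]; last exact: f_iinv.
  by apply: fI; rewrite f_iinv.
split; first by apply/injectiveP; exact: can_inj fK.
by apply/forallP => y; rewrite -(gK y) codom_f.
Qed.

Definition symdiff (T : finType) (A B : {set T}) : {set T} :=
  (A :\: B) :|: (B :\: A).

Definition edit_cost (V V' : finType) (G : sgraph V) (G' : sgraph V')
    (f : {ffun V -> V'}) : nat :=
  #|symdiff [set f @: e | e : {set V} in edges G] (edges G')|.

(* The default value of the iterated minimum bounds every cost from above, so
   it does not affect the minimum as soon as some bijection exists; see
   edit_distP. *)
Definition edit_dist (V V' : finType) (G : sgraph V) (G' : sgraph V') : nat :=
  \big[minn/#|edges G| + #|edges G'|]_(f : {ffun V -> V'} | bijectiveb f)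
    edit_cost G G' f.

Lemma edit_cost_le (V V' : finType) (G : sgraph V) (G' : sgraph V')
    (f : {ffun V -> V'}) :
  edit_cost G G' f <= #|edges G| + #|edges G'|.
Proof.
rewrite /edit_cost /symdiff (leq_trans (leq_card_setU _ _)) //.
apply: leq_add; last exact: subset_leq_card (subsetDl _ _).
apply: leq_trans (subset_leq_card (subsetDl _ _)) _.
exact: leq_imset_card.
Qed.

Lemma edit_distP (V V' : finType) (G : sgraph V) (G' : sgraph V') :
  #|V| = #|V'| ->
  (exists2 f : {ffun V -> V'}, bijective f & edit_dist G G' = edit_cost G G' f)
  /\ (forall f : {ffun V -> V'}, bijective f ->
        edit_dist G G' <= edit_cost G G' f).
Proof.
move=> VV'.
have le_dist (f : {ffun V -> V'}) :
    bijective f -> edit_dist G G' <= edit_cost G G' f.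
  move/bijectiveP => fB; rewrite /edit_dist; have := mem_index_enum f.
  elim: (index_enum _) => //= g s IHs; rewrite inE big_cons.
  case/predU1P=> [<-|/IHs le_s]; first by rewrite fB geq_minl.
  by case: ifP => // _; apply: leq_trans (geq_minr _ _) le_s.
split=> //; have [g gB] : exists g : {ffun V -> V'}, bijective g.
  exists [ffun x => enum_val (cast_ord VV' (enum_rank x))].
  exists (fun y => enum_val (cast_ord (esym VV') (enum_rank y))) => x.
    by rewrite ffunE enum_valK cast_ordK enum_rankK.
  by rewrite ffunE enum_valK cast_ordKV enum_rankK.
have : edit_dist G G' = #|edges G| + #|edges G'| \/
    exists2 f : {ffun V -> V'}, bijective f & edit_dist G G' = edit_cost G G' f.
  rewrite /edit_dist; elim/big_ind: _ => [|x y Hx Hy|f /bijectiveP fB].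
  - by left.
  - by case: (leqP x y).
  - by right; exists f.
case=> // E; exists g => //; apply/eqP; rewrite eqn_leq le_dist //=.
by rewrite E edit_cost_le.
Qed.

Definition Kbip_edges (a b : nat) : {set {set 'I_a + 'I_b}} :=
  [set [set inl i; inr j] | i in 'I_a, j in 'I_b].

Lemma Kbip_card2 (a b : nat) : [forall e in Kbip_edges a b, #|e| == 2].
Proof. by apply/forall_inP => e /imset2P[i j _ _ ->]; rewrite cards2. Qed.

Definition Kbip (a b : nat) : sgraph ('I_a + 'I_b)%type :=
  SGraph (Kbip_card2 a b).

Lemma card_Kbip_half (n : nat) : #|{: 'I_n./2 + 'I_(uphalf n)}| = n.
Proof.
by rewrite card_sum !card_ord addnC uphalf_half -addnA addnn odd_double_half.
Qed.

Definition v4 (k : nat) : 'I_4 := inord k.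

Definition redH_edges : {set {set 'I_4}} := [set [set v4 0; v4 2]].

Definition blueH_edges : {set {set 'I_4}} :=
  [set [set v4 0; v4 1]; [set v4 0; v4 3]; [set v4 1; v4 3]].

Lemma redH_card2 : [forall e in redH_edges, #|e| == 2].
Proof. by apply/forall_inP => e /set1P->; rewrite cards2 -val_eqE /= !inordK. Qed.

Lemma blueH_card2 : [forall e in blueH_edges, #|e| == 2].
Proof.
by apply/forall_inP => e; rewrite !inE -orbA => /or3P[] /eqP->;
  rewrite cards2 -val_eqE /= !inordK.
Qed.

Lemma redblueH_disjoint :
  [disjoint edges (SGraph redH_card2) & edges (SGraph blueH_card2)].
Proof.
rewrite /= disjoints1 !inE !negb_or -andbA; apply/and3P.
by split; apply/eqP => /setP/(_ (v4 2));
  rewrite !inE -!val_eqE /= !inordK.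
Qed.

Definition Hgraph : cgraph 'I_4 := CGraph redblueH_disjoint.

(* Main.v *)
Require Import Defs.
From Stdlib Require Import ZArith.
From mathcomp Require Import all_boot all_order all_algebra.
From mathcomp Require Import reals.
From mathcomp Require Import ssrZ zify ring lra.

Set Implicit Arguments.
Unset Strict Implicit.
Unset Printing Implicit Defensive.

Import Order.TTheory GRing.Theory Num.Theory.

(* Let s(x, y) be -1 if xy is an edge and 1 otherwise (also for x = y), let F be
   the number of quadruples (x, y, z, u), repetitions allowed, with x, y, z
   pairwise non-adjacent and x adjacent to u, and let A be the number of ordered
   triangles.  Then Lambda_H(G) <= F, and a sum-of-squares (flag algebra)
   certificate on 5-tuples of vertices gives
     200 F + (sum_{x,y} s(x, y))^2 + 2 n A <= 25 n^4.
   Hence a nearly maximal lambda forces sum s = o(n^2) and A = o(n^3).  Call a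
   triple negative if it spans an odd number of edges, and let D(x) be
   sum_y s(x, y).  Since
     3 sum_x D(x)^2 + 2 #{negative triples} = 3 n sum s + 8 A,
   some vertex x has D(x) = o(n) and lies in o(n^2) negative triples (x, y, z).
   The partition into neighbours and non-neighbours of x is then nearly
   balanced, and the pairs yz on which G disagrees with the complete bipartite
   graph on it are those for which (x, y, z) is negative. *)

(* The ten booleans are the adjacencies of the pairs
   xy xz xu xv yz yu yv zu zv uv, in this order. *)
Definition ten (T : Type) : Type :=
  bool -> bool -> bool -> bool -> bool -> bool -> bool -> bool -> bool -> bool
  -> T.

(** * The flag algebra certificate, over the integers *)

Section Certificate.
Local Open Scope Z_scope.

Definition sgZ (b : bool) : Z := if b then -1 else 1.

Definition vertexZ (xy xz yz : bool) : Z :=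
  8 * (sgZ xy * sgZ xz) + 16 * sgZ yz - 7 * (1 - sgZ xy * sgZ xz * sgZ yz)
  - sgZ xy + sgZ xy * sgZ yz.

(** Exchanging y and z is an automorphism of a [cherry]; [skewZ] is odd and [evenZ] even under it,
    so their squares enter [certificate] without a mixed term. *)
Definition skewZ (xu yu zu : bool) : Z :=
  if xu then 0 else Z.b2z zu - Z.b2z yu.

Definition evenZ (xu yu zu : bool) : Z :=
  if xu then - (if yu then Z.b2z (~~ zu) else if zu then 1 else 3)
  else Z.b2z (~~ yu && ~~ zu).

Definition cherry (xy xz yz : bool) : bool := [&& ~~ xy, ~~ xz & yz].

Definition fan (xy xz yz xu : bool) : bool := [&& ~~ xy, ~~ xz, ~~ yz & xu].

(* The coefficients round a numerical solution of the semidefinite program of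
   order 5.  The bound is tight on K_{a,a}, and tight to first order when an
   isolated vertex of small weight is added, so the shapes of vertexZ, skewZ
   and evenZ make the three sums squared in total_certificateE vanish there. *)
Definition certificate : ten Z := fun xy xz xu xv yz yu yv zu zv uv =>
  600 - 4800 * Z.b2z (fan xy xz yz xu) - 24 * (sgZ xy * sgZ uv)
  - 48 * Z.b2z [&& xy, xz & yz] - vertexZ xy xz yz * vertexZ xu xv uv
  - Z.b2z (cherry xy xz yz) *
    (2880 * (skewZ xu yu zu * skewZ xv yv zv)
     + 384 * (evenZ xu yu zu * evenZ xv yv zv)).

Definition add10 (f g : ten Z) : ten Z := fun a b c d e h i j k l =>
  f a b c d e h i j k l + g a b c d e h i j k l.

End Certificate.

(** * Symmetrization over the orderings of five vertices *)

Section Transpositions.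
Variables (T : Type) (f : ten T).

Definition swap12 : ten T := fun xy xz xu xv yz yu yv zu zv uv =>
  f xy yz yu yv xz xu xv zu zv uv.
Definition swap23 : ten T := fun xy xz xu xv yz yu yv zu zv uv =>
  f xz xy xu xv yz zu zv yu yv uv.
Definition swap34 : ten T := fun xy xz xu xv yz yu yv zu zv uv =>
  f xy xu xz xv yu yz yv zu uv zv.
Definition swap45 : ten T := fun xy xz xu xv yz yu yv zu zv uv =>
  f xy xz xv xu yz yv yu zv zu uv.

End Transpositions.

Definition sym2 (f : ten Z) : ten Z := add10 f (swap12 f).
Definition sym3 (f : ten Z) : ten Z := add10 f (swap23 (sym2 f)).
Definition sym4 (f : ten Z) : ten Z := add10 f (swap34 (sym3 f)).
Definition sym5 (f : ten Z) : ten Z := add10 f (swap45 (sym4 f)).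

Definition allb (p : pred bool) : bool := p true && p false.

Lemma allbP (p : pred bool) : allb p -> forall b, p b.
Proof. by case/andP=> pt pf []. Qed.

Definition nonneg10 (f : ten Z) : bool :=
  allb (fun a => allb (fun b => allb (fun c => allb (fun d => allb (fun e =>
  allb (fun g => allb (fun h => allb (fun i => allb (fun j => allb (fun k =>
  Z.leb 0 (f a b c d e g h i j k))))))))))).

Lemma nonneg10P (f : ten Z) : nonneg10 f ->
  forall a b c d e g h i j k, Z.leb 0 (f a b c d e g h i j k).
Proof.
move=> nf a b c d e g h i j k.
by move: nf => /allbP/(_ a)/allbP/(_ b)/allbP/(_ c)/allbP/(_ d)/allbP/(_ e)
  /allbP/(_ g)/allbP/(_ h)/allbP/(_ i)/allbP/(_ j)/allbP/(_ k).
Qed.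

(* The product of these four partial symmetrizations, over coset representatives,
   is the sum over all permutations of the five vertices. *)
Lemma certificate_sym_ge0 : nonneg10 (sym2 (sym3 (sym4 (sym5 certificate)))).
Proof. by vm_compute. Qed.

Local Open Scope ring_scope.

(** * The density inequality obtained by summing over 5-tuples *)

Section Density.
Variables (R : realFieldType) (V : finType) (e : rel V).
Hypothesis e_sym : symmetric e.

(** The certificate lives in [Z] so that its 1024 values can be evaluated; [zr] carries them to the
    field. *)
Definition zr (z : Z) : R := (int_of_Z z)%:~R.

Lemma zrD a b : zr (Z.add a b) = zr a + zr b.
Proof. by rewrite /zr -rmorphD -(rmorphD int_of_Z). Qed.
Lemma zrM a b : zr (Z.mul a b) = zr a * zr b.
Proof. by rewrite /zr -rmorphM -(rmorphM int_of_Z). Qed.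
Lemma zrN a : zr (Z.opp a) = - zr a.
Proof. by rewrite /zr -rmorphN -(rmorphN int_of_Z). Qed.
Lemma zrB a b : zr (Z.sub a b) = zr a - zr b.
Proof. by rewrite -zrN -zrD. Qed.
Lemma zr_bool (b : bool) : zr (Z.b2z b) = b%:R.
Proof. by case: b. Qed.
Lemma zr_ge0 a : Z.leb 0 a -> 0 <= zr a.
Proof. by case: a => // p _; rewrite /zr /= ler0n. Qed.

Definition total (f : ten Z) : R :=
  \sum_x \sum_y \sum_z \sum_u \sum_v
    zr (f (e x y) (e x z) (e x u) (e x v) (e y z) (e y u) (e y v) (e z u)
          (e z v) (e u v)).

Lemma total_add10 f g : total (add10 f g) = total f + total g.
Proof.
rewrite /total -big_split; apply: eq_bigr => x _ /=.
rewrite -big_split; apply: eq_bigr => y _ /=.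
rewrite -big_split; apply: eq_bigr => z _ /=.
rewrite -big_split; apply: eq_bigr => u _ /=.
by rewrite -big_split; apply: eq_bigr => v _ /=; rewrite zrD.
Qed.

Lemma total_swap12 f : total (swap12 f) = total f.
Proof.
rewrite /total exchange_big; apply: eq_bigr => x _; apply: eq_bigr => y _.
do 3 (apply: eq_bigr => ? _).
by rewrite /swap12 [e y x]e_sym.
Qed.

Lemma total_swap23 f : total (swap23 f) = total f.
Proof.
rewrite /total; apply: eq_bigr => x _; rewrite exchange_big.
apply: eq_bigr => y _; apply: eq_bigr => z _.
by do 2 (apply: eq_bigr => ? _); rewrite /swap23 [e z y]e_sym.
Qed.

Lemma total_swap34 f : total (swap34 f) = total f.
Proof.
rewrite /total; do 2 (apply: eq_bigr => ? _); rewrite exchange_big.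
apply: eq_bigr => y _; apply: eq_bigr => z _.
by apply: eq_bigr => ? _; rewrite /swap34 [e z y]e_sym.
Qed.

Lemma total_swap45 f : total (swap45 f) = total f.
Proof.
rewrite /total; do 3 (apply: eq_bigr => ? _); rewrite exchange_big.
apply: eq_bigr => y _; apply: eq_bigr => z _.
by rewrite /swap45 [e z y]e_sym.
Qed.

(** Relabelling vertices preserves [total], so the partial symmetrizations multiply it by 2, 3, 4
    and 5. *)
Lemma total_sym f :
  total (sym2 (sym3 (sym4 (sym5 f)))) = 120 * total f.
Proof.
have E2 g : total (sym2 g) = 2 * total g.
  by rewrite /sym2 total_add10 total_swap12; ring.
have E3 g : total (sym3 g) = 3 * total g.
  by rewrite /sym3 total_add10 total_swap23 E2; ring.
have E4 g : total (sym4 g) = 4 * total g.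
  by rewrite /sym4 total_add10 total_swap34 E3; ring.
have E5 g : total (sym5 g) = 5 * total g.
  by rewrite /sym5 total_add10 total_swap45 E4; ring.
by rewrite E2 E3 E4 E5; ring.
Qed.

Lemma total_certificate_ge0 : 0 <= total certificate.
Proof.
rewrite -(pmulr_rge0 _ (_ : 0 < 120)) ?ltr0n // -total_sym.
do 5 (apply: sumr_ge0 => ? _); apply: zr_ge0.
exact: nonneg10P certificate_sym_ge0 _ _ _ _ _ _ _ _ _ _.
Qed.

Definition sg (x y : V) : R := (-1) ^+ e x y.
Definition fans : R :=
  \sum_x \sum_y \sum_z \sum_u (fan (e x y) (e x z) (e y z) (e x u))%:R.
Definition triangles : R :=
  \sum_x \sum_y \sum_z [&& e x y, e x z & e y z]%:R.
Definition sg_sum : R := \sum_x \sum_y sg x y.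

Lemma zr_sgZ x y : zr (sgZ (e x y)) = sg x y.
Proof. by rewrite /sg /zr; case: (e x y). Qed.

Lemma double_sum_mul (a b : V -> V -> R) :
  (\sum_x \sum_y a x y) * (\sum_x \sum_y b x y) =
  \sum_x \sum_y \sum_z \sum_u a x y * b z u.
Proof.
rewrite mulr_suml; apply: eq_bigr => x _.
rewrite mulr_suml; apply: eq_bigr => y _.
rewrite mulr_sumr; apply: eq_bigr => z _.
by rewrite mulr_sumr.
Qed.

Lemma sum_mul (a b : V -> R) :
  (\sum_x a x) * (\sum_x b x) = \sum_x \sum_y a x * b y.
Proof. by rewrite mulr_suml; apply: eq_bigr => x _; rewrite mulr_sumr. Qed.

(** Each vertex that a term does not mention contributes a factor [#|V|]; products of two flags over
    a common type sum to squares. *)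
Lemma total_certificateE : total certificate =
  600 * #|V|%:R ^+ 5 - 4800 * (#|V|%:R * fans) - 24 * (#|V|%:R * sg_sum ^+ 2)
  - 48 * (#|V|%:R ^+ 2 * triangles)
  - \sum_x (\sum_y \sum_z zr (vertexZ (e x y) (e x z) (e y z))) ^+ 2
  - \sum_x \sum_y \sum_z (cherry (e x y) (e x z) (e y z))%:R *
     (2880 * (\sum_u zr (skewZ (e x u) (e y u) (e z u))) ^+ 2
      + 384 * (\sum_u zr (evenZ (e x u) (e y u) (e z u))) ^+ 2).
Proof.
have sumC (c : R) : \sum_(x : V) c = #|V|%:R * c.
  by rewrite sumr_const mulr_natl.
have -> : 600 * #|V|%:R ^+ 5 =
    \sum_(x : V) \sum_(y : V) \sum_(z : V) \sum_(u : V) \sum_(v : V) (600 : R).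
  by rewrite !sumC; ring.
have -> : #|V|%:R * fans = \sum_x \sum_y \sum_z \sum_u \sum_(v : V)
    (fan (e x y) (e x z) (e y z) (e x u))%:R.
  rewrite /fans mulr_sumr; apply: eq_bigr => x _.
  rewrite mulr_sumr; apply: eq_bigr => y _.
  rewrite mulr_sumr; apply: eq_bigr => z _.
  by rewrite mulr_sumr; apply: eq_bigr => u _; rewrite sumC.
have -> : #|V|%:R * sg_sum ^+ 2 = \sum_x \sum_y \sum_(z : V) \sum_u \sum_v
    sg x y * sg u v.
  rewrite expr2 double_sum_mul mulr_sumr; apply: eq_bigr => x _.
  by rewrite mulr_sumr; apply: eq_bigr => y _; rewrite sumC.
have -> : #|V|%:R ^+ 2 * triangles = \sum_x \sum_y \sum_z \sum_(u : V)
    \sum_(v : V) [&& e x y, e x z & e y z]%:R.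
  rewrite /triangles mulr_sumr; apply: eq_bigr => x _.
  rewrite mulr_sumr; apply: eq_bigr => y _.
  rewrite mulr_sumr; apply: eq_bigr => z _.
  by rewrite !sumC mulrA.
rewrite !mulr_sumr -!sumrB; apply: eq_bigr => x _.
rewrite !mulr_sumr expr2 double_sum_mul -!sumrB; apply: eq_bigr => y _.
rewrite !mulr_sumr -!sumrB; apply: eq_bigr => z _.
rewrite !expr2 !sum_mul !mulr_sumr -big_split mulr_sumr -!sumrB.
apply: eq_bigr => u _.
rewrite /= !mulr_sumr -big_split mulr_sumr -!sumrB; apply: eq_bigr => v _.
rewrite /certificate !zrB !zrM !zr_sgZ !zr_bool zrD !zrM.
have zr_nat (k : nat) (a : Z) : int_of_Z a = k -> zr a = k%:R.
  by move=> ak; rewrite /zr ak.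
rewrite (zr_nat 600%N) // (zr_nat 4800%N) // (zr_nat 24%N) // (zr_nat 48%N) //.
Qed.

Lemma fans_bound :
  200 * fans + sg_sum ^+ 2 + 2 * #|V|%:R * triangles <= 25 * #|V|%:R ^+ 4.
Proof.
case: (posnP #|V|) => [V0|V_gt0].
  have no (a : V -> R) : \sum_x a x = 0.
    by rewrite big1 // => x _; have := card0_eq V0 x; rewrite !inE.
  by rewrite /fans /sg_sum !no V0; lra.
(* Scaled by 24n, the claim is the expanded certificate with its subtracted sums of squares
   dropped. *)
rewrite -(ler_pM2l (_ : 0 < 24 * #|V|%:R)) ?mulr_gt0 ?ltr0n //.
have := total_certificate_ge0; rewrite total_certificateE.
have : 0 <= \sum_x (\sum_y \sum_z zr (vertexZ (e x y) (e x z) (e y z))) ^+ 2.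
  by apply: sumr_ge0 => x _; exact: sqr_ge0.
have : 0 <= \sum_x \sum_y \sum_z (cherry (e x y) (e x z) (e y z))%:R *
     (2880 * (\sum_u zr (skewZ (e x u) (e y u) (e z u))) ^+ 2
      + 384 * (\sum_u zr (evenZ (e x u) (e y u) (e z u))) ^+ 2).
  do 3 (apply: sumr_ge0 => ? _).
  by rewrite mulr_ge0 ?ler0n // addr_ge0 // mulr_ge0 ?ler0n ?sqr_ge0.
lra.
Qed.

(** * Negative triples, signed degrees and a balanced vertex *)

Definition neg_sum (x : V) : R :=
  \sum_y \sum_z (e x y (+) e x z (+) e y z)%:R.
Definition sg_deg (x : V) : R := \sum_y sg x y.

Lemma sum_rot (h : V -> V -> V -> R) :
  \sum_x \sum_y \sum_z h y z x = \sum_x \sum_y \sum_z h x y z.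
Proof.
by rewrite exchange_big; apply: eq_bigr => y _; rewrite exchange_big.
Qed.

(* Summing the difference of the two sides over the rotations of (x, y, z) makes
   it vanish termwise. *)
Lemma neg_sum_identity :
  \sum_x (3 * sg_deg x ^+ 2 + 2 * neg_sum x) =
  3 * #|V|%:R * sg_sum + 8 * triangles.
Proof.
pose h x y z := 3 * (sg x y * sg x z) + 2 * (e x y (+) e x z (+) e y z)%:R
  - (3 * sg y z + 8 * [&& e x y, e x z & e y z]%:R).
have -> : 3 * #|V|%:R * sg_sum = \sum_(x : V) \sum_y \sum_z 3 * sg y z.
  rewrite sumr_const -[RHS]mulr_natl [3 * _]mulrC -mulrA; congr (_ * _).
  rewrite /sg_sum mulr_sumr; apply: eq_bigr => y _.
  by rewrite mulr_sumr.
apply/eqP; rewrite -subr_eq0; apply/eqP.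
have -> : \sum_x (3 * sg_deg x ^+ 2 + 2 * neg_sum x) -
    (\sum_(x : V) \sum_y \sum_z 3 * sg y z + 8 * triangles) =
    \sum_x \sum_y \sum_z h x y z.
  rewrite /triangles mulr_sumr -big_split -sumrB; apply: eq_bigr => x _.
  rewrite /= expr2 sum_mul !mulr_sumr -!big_split -sumrB; apply: eq_bigr => y _.
  by rewrite /= !mulr_sumr -!big_split -sumrB.
apply: (@mulfI _ 3); rewrite ?pnatr_eq0 // mulr0.
have -> : 3 * (\sum_x \sum_y \sum_z h x y z) =
    \sum_x \sum_y \sum_z h x y z + \sum_x \sum_y \sum_z h y z x
    + \sum_x \sum_y \sum_z h z x y.
  rewrite sum_rot (sum_rot (fun x y z => h y z x)) sum_rot; ring.
rewrite -!big_split big1 // => x _ /=; rewrite -!big_split big1 // => y _ /=.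
rewrite -!big_split big1 // => z _ /=.
rewrite /h /sg [e y x]e_sym [e z x]e_sym [e z y]e_sym.
by case: (e x y); case: (e x z); case: (e y z); rewrite /= ?expr0 ?expr1; ring.
Qed.

Lemma exists_le_mean (a : V -> R) (c : R) : (0 < #|V|)%N ->
  \sum_x a x <= c * #|V|%:R -> exists x, a x <= c.
Proof.
move=> V_gt0 sum_le; apply/existsP; apply: contraTT sum_le => /existsPn gt_c.
rewrite -ltNge mulr_natr -sumr_const.
have [x0 _] := card_gt0P V_gt0; apply: ltr_sum => [|x _]; last first.
  by rewrite ltNge gt_c.
by apply/hasP; exists x0; rewrite ?mem_index_enum.
Qed.

Lemma exists_balanced_vertex (eta : R) : 0 <= eta <= 1 -> (0 < #|V|)%N ->
  (1 / 8 - eta ^+ 2 / 200) * #|V|%:R ^+ 4 <= fans ->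
  exists x, 3 * sg_deg x ^+ 2 + 2 * neg_sum x <= 7 * eta * #|V|%:R ^+ 2.
Proof.
move=> /andP[eta_ge0 eta_le1] V_gt0 fans_ge; apply: exists_le_mean => //.
rewrite neg_sum_identity; have := fans_bound.
have : 0 <= triangles by do 3 (apply: sumr_ge0 => ? _); exact: ler0n.
have : 0 < #|V|%:R :> R by rewrite ltr0n.
move: fans_ge; set n : R := #|V|%:R; set t := triangles; set s := sg_sum.
set F := fans => F_ge n_gt0 t_ge0 bound.
(* The deficit [eta ^+ 2 / 200] in [fans], times 200, is all that remains of 25 n^4. Then 3ns + 8t
   is at most (3 + 4) eta n^3, whence the 7. *)
have sum_le : s ^+ 2 + 2 * n * t <= (eta * n ^+ 2) ^+ 2.
  by rewrite exprMn -exprM; lra.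
have nt_ge0 : 0 <= 2 * n * t by rewrite !mulr_ge0 ?ler0n // ltW.
have s_le : s <= eta * n ^+ 2.
  apply: le_trans (ler_norm s) _.
  rewrite -ler_sqr ?nnegrE ?mulr_ge0 ?sqr_ge0 // real_normK ?num_real //.
  lra.
have t_le : 2 * t <= eta * n ^+ 3.
  rewrite -(ler_pM2l n_gt0); apply: le_trans (_ : (eta * n ^+ 2) ^+ 2 <= _).
    by have := sqr_ge0 s; lra.
  rewrite exprMn -exprM [n * _]mulrCA -exprS ler_wpM2r ?exprn_ge0 ?(ltW n_gt0) //.
  by rewrite expr2 ler_piMl.
have : n * s <= n * (eta * n ^+ 2) by rewrite ler_pM2l.
by rewrite [n ^+ 3]exprS in t_le; lra.
Qed.

End Density.

(** * From a balanced vertex to the edit distance *)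

Section Graphs.
Variables (V : finType) (G : sgraph V).

Definition adj (x y : V) : bool := [set x; y] \in edges G.

Lemma adj_sym : symmetric adj.
Proof. by move=> x y; rewrite /adj setUC. Qed.

Lemma adj_irr x : adj x x = false.
Proof.
apply/negP => /(forall_inP (edges_card2 G)).
by rewrite setUid cards1.
Qed.

Lemma fansE (R : realFieldType) : fans R adj =
  #|[set t : V * V * V * V | fan (adj t.1.1.1 t.1.1.2) (adj t.1.1.1 t.1.2)
      (adj t.1.1.2 t.1.2) (adj t.1.1.1 t.2)]|%:R.
Proof.
rewrite /fans cardsE -sum1_card natr_sum [RHS]big_mkcond /=.
rewrite pair_bigA pair_bigA pair_bigA /=.
by apply: eq_bigr => t _; rewrite unfold_in /fan; case: [&& _, _, _ & _].
Qed.

Lemma Lambda_le_fans (R : realFieldType) : (Lambda Hgraph G)%:R <= fans R adj.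
Proof.
rewrite fansE ler_nat.
(* The blue triangle 0, 1, 3 comes first and the red neighbour 2 of vertex 0 last, as in [fan]. *)
pose h (f : {ffun 'I_4 -> V}) := (f (v4 0), f (v4 1), f (v4 3), f (v4 2)).
have h_inj : injective h.
  move=> f g [f0 f1 f3 f2]; apply/ffunP => i.
  have -> : i = v4 i by rewrite /v4 inord_val.
  by case: i => [[|[|[|[|]]]]].
rewrite /Lambda -(card_imset _ h_inj); apply/subset_leq_card/subsetP => t.
case/imsetP => f; rewrite 2!inE => /and3P[_ /forall_inP red_f /forall_inP blue_f].
have pairE i j : f @: [set i; j] = [set f i; f j] by rewrite imsetU1 imset_set1.
have Gred : adj (f (v4 0)) (f (v4 2)).
  by rewrite /adj -pairE; apply: red_f; rewrite inE.
have Gblue i j : [set i; j] \in blueH_edges -> ~~ adj (f i) (f j).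
  by move=> /blue_f; rewrite pairE inE => /andP[].
move=> ->; rewrite /fan /= Gred !Gblue //.
all: by rewrite !inE eqxx ?orbT.
Qed.

Variable x : V.
Let N : {set V} := [set y | ~~ adj x y].
Let s := enum N ++ enum (~: N).

Let size_s : size s = #|V|.
Proof. by rewrite size_cat -!cardE cardsC. Qed.

Let mem_s y : y \in s.
Proof. by rewrite mem_cat !mem_enum in_setC orbN. Qed.

Let index_lt y : (index y s < #|V|)%N.
Proof. by rewrite -size_s index_mem. Qed.

Let index_inj : injective (index^~ s).
Proof.
by move=> y z yz; rewrite -(nth_index y (mem_s y)) yz nth_index.
Qed.

Let index_ltN y : (index y s < #|N|)%N = (y \in N).
Proof.
rewrite index_cat mem_enum; case: ifP => yN.
  by rewrite cardE index_mem mem_enum.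
by rewrite -cardE ltnNge leq_addr.
Qed.

Let half_eq : #|V| = (#|V|./2 + uphalf #|V|)%N.
Proof. by rewrite uphalf_half addnCA addnn odd_double_half. Qed.

(** The target has parts of prescribed sizes, so [s] is cut at its middle and not at the end of
    [N]. *)
Let f : {ffun V -> 'I_#|V|./2 + 'I_(uphalf #|V|)} :=
  [ffun y => split (cast_ord half_eq (Ordinal (index_lt y)))].

Let left y : bool := (index y s < #|V|./2)%N.

Let f_bij : bijective f.
Proof.
apply: inj_card_bij => [y z|]; last by rewrite card_Kbip_half.
rewrite !ffunE => /(can_inj (@splitK _ _)) /cast_ord_inj /(congr1 val).
exact: index_inj.
Qed.

Let f_left y : left y = if f y is inl _ then true else false.
Proof.
rewrite ffunE; case: splitP => j /= jE; rewrite /left jE ?ltn_ord //.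
by rewrite ltnNge leq_addr.
Qed.

Let wrong : {set V * V} :=
  [set p | adj p.1 p.2 != (left p.1 != left p.2)].

Lemma edit_cost_wrong :
  (edit_cost G (Kbip #|V|./2 (uphalf #|V|)) f <= #|wrong|)%N.
Proof.
have pairE y z : f @: [set y; z] = [set f y; f z] by rewrite imsetU1 imset_set1.
apply: leq_trans (leq_imset_card (fun p => [set f p.1; f p.2]) wrong).
apply/subset_leq_card/subsetP => t; rewrite in_setU !in_setD.
case/orP => /andP[].
- move=> t_bip /imsetP[d dG tE].
  have /cards2P[y [z [_ dE]]] := forall_inP (edges_card2 G) d dG.
  rewrite dE pairE in tE; apply/imsetP; exists (y, z) => //.
  rewrite inE /=; have -> : adj y z by rewrite /adj -dE.
  apply/eqP => /esym lyz; case/negP: t_bip; rewrite tE.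
  move: lyz; rewrite !f_left.
  case: (f y) => i; case: (f z) => j //= _.
    by apply/imset2P; exists i j.
  by rewrite setUC; apply/imset2P; exists j i.
- move=> t_img /imset2P[i j _ _ tE].
  have [g fK gK] := f_bij.
  have tE' : t = [set f (g (inl i)); f (g (inr j))] by rewrite !gK.
  apply/imsetP; exists (g (inl i), g (inr j)) => //=.
  rewrite inE /= !f_left !gK; have [adj_ij|//] := boolP (adj _ _).
  case/negP: t_img; apply/imsetP; exists [set g (inl i); g (inr j)] => //.
  by rewrite pairE.
Qed.

(* N is put first in the ordering s, so the first half of s differs from N only
   on the positions between n / 2 and #|N|. *)
Let moved : {set V} := [set y | left y != (y \in N)].

(** If neither end of a wrong pair is moved, its sides are given by adjacency to x, so it forms a
    negative triple with x. *)
Lemma card_wrong :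
  (#|wrong| <= #|[set p : V * V | adj x p.1 (+) adj x p.2 (+) adj p.1 p.2]|
     + 2 * (#|V| * #|moved|))%N.
Proof.
set B := [set p : V * V | _].
have sub : wrong \subset B :|: (setX moved setT :|: setX setT moved).
  apply/subsetP => -[y z]; rewrite !inE /=.
  by case: (left y); case: (left z); case: (adj x y); case: (adj x z);
    case: (adj y z).
apply: leq_trans (subset_leq_card sub) _.
apply: leq_trans (leq_card_setU _ _) _; rewrite leq_add2l.
apply: leq_trans (leq_card_setU _ _) _.
by rewrite !cardsX cardsT mulnC addnn mul2n.
Qed.

Lemma card_moved :
  (#|moved| <= maxn #|V|./2 #|N| - minn #|V|./2 #|N|)%N.
Proof.
set a := #|V|./2; set k := #|N|.
rewrite cardE -(size_map (index^~ s)).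
rewrite -(size_iota (minn a k) (maxn a k - minn a k)).
apply: uniq_leq_size; first by rewrite map_inj_uniq ?enum_uniq.
move=> _ /mapP[y + ->]; rewrite mem_enum inE -index_ltN /left mem_iota -/a -/k.
lia.
Qed.

Lemma edit_dist_le (R : realFieldType) :
  (edit_dist G (Kbip #|V|./2 (uphalf #|V|)))%:R <=
    neg_sum R adj x + #|V|%:R * (`|sg_deg R adj x| + 1).
Proof.
have negE : neg_sum R adj x =
    #|[set p : V * V | adj x p.1 (+) adj x p.2 (+) adj p.1 p.2]|%:R.
  rewrite /neg_sum cardsE -sum1_card natr_sum [RHS]big_mkcond pair_bigA /=.
  by apply: eq_bigr => p _; rewrite unfold_in; case: (_ (+) _).
have degE : sg_deg R adj x = 2 * #|N|%:R - #|V|%:R.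
  rewrite -(cardsC N) natrD [LHS](bigID (mem N)) /=.
  have -> : \sum_(y in N) sg R adj x y = #|N|%:R.
    rewrite -sum1_card natr_sum; apply: eq_bigr => y.
    by rewrite inE /sg => /negbTE ->.
  have -> : \sum_(y | y \notin N) sg R adj x y = - #|~: N|%:R.
    rewrite -sum1_card natr_sum -sumrN; apply: eq_big => y; rewrite !inE //.
    by rewrite negbK /sg => ->.
  by ring.
have [_ dist_le] := edit_distP G (Kbip #|V|./2 (uphalf #|V|))
  (esym (card_Kbip_half #|V|)).
have moved2 : (2 * #|moved|)%:R <= `|sg_deg R adj x| + 1.
  have := card_moved; rewrite degE; move: #|moved| #|N| #|V| => m k n m_le.
  have := ler_norm (2 * k%:R - n%:R : R).
  have := ler_norm (- (2 * k%:R - n%:R : R)); rewrite normrN natrM.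
  (* The extra 1 comes from rounding n/2 down when [N] exceeds half of the vertices. *)
  have [le_n|le_k] : (2 * m + 2 * k <= n \/ 2 * m + n <= 2 * k + 1)%N by lia.
  - have : 2 * m%:R + 2 * k%:R <= n%:R :> R.
      by rewrite -!natrM -natrD ler_nat.
    lra.
  - have : 2 * m%:R + n%:R <= 2 * k%:R + 1 :> R.
      by rewrite -!natrM -natrD natr1 ler_nat; lia.
    lra.
have := leq_trans (dist_le f f_bij) (leq_trans edit_cost_wrong card_wrong).
rewrite -(ler_nat R) natrD -negE mulnCA natrM => le_dist.
by apply: le_trans le_dist _; rewrite lerD2l ler_wpM2l ?ler0n.
Qed.

End Graphs.

(** * Falling factorials and the choice of constants *)

Lemma ffact4_ge (R : realFieldType) (n : nat) : (3 <= n)%N ->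
  n%:R ^+ 4 - 6 * n%:R ^+ 3 <= (n ^_ 4)%:R :> R.
Proof.
move=> n_ge3.
have -> : (n ^_ 4)%:R = n%:R * (n%:R - 1) * (n%:R - 2) * (n%:R - 3) :> R.
  by rewrite !ffactnSr ffactn0 !natrM !natrB ?subn0 //; [ring|lia..].
have : 3 <= n%:R :> R by rewrite ler_nat.
nra.
Qed.

Theorem lemma3p14 (R : realType) (eps : R) (eps_gt0 : 0 < eps) :
  exists2 delta : R, 0 < delta &
  exists n0 : nat, forall (V : finType) (G : sgraph V),
    (n0 <= #|V|)%N ->
    1 / 8 - delta <= lambda R Hgraph G ->
    (edit_dist G (Kbip #|V|./2 (uphalf #|V|)))%:R <= eps * #|V|%:R ^+ 2.
Proof.
(* From 3D^2 + 2m <= 7 eta n^2, the bound eps/14 controls m and eps^2/14 controls D. *)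
pose eta := Num.min 1 (Num.min (eps / 14) (eps ^+ 2 / 14)).
have eta_gt0 : 0 < eta.
  by rewrite !lt_min ltr01 !divr_gt0 ?exprn_gt0 ?ltr0n.
have eta_le1 : eta <= 1 by rewrite ge_min lexx.
have eta_le : eta <= eps / 14 by rewrite !ge_min lexx !orbT.
have eta_le2 : eta <= eps ^+ 2 / 14 by rewrite !ge_min lexx !orbT.
(* Half of the deficit allowed in [fans]; the other half absorbs the gap between [n ^_ 4] and
   n^4. *)
pose delta := eta ^+ 2 / 400.
have delta_gt0 : 0 < delta by rewrite divr_gt0 ?exprn_gt0 ?ltr0n.
have delta_le : delta <= 1 / 400.
  by rewrite ler_pM2r ?invr_gt0 ?ltr0n // expr_le1 // ltW.
exists delta => //.
(* The 4 keeps the denominator of [lambda] nonzero, 8/eps handles the rounding term n, and the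
   inverse of [delta] the n^3 loss. *)
exists (maxn 4 (Num.bound (8 / eps + delta^-1))) => V G.
rewrite geq_max => /andP[n_ge4 n_ge_bound] lambda_ge.
set n : R := #|V|%:R.
have n_gt0 : 0 < n by rewrite ltr0n; apply: leq_trans n_ge4.
have [eps_n delta_n] : 8 <= eps * n /\ 1 <= delta * n.
  have ie : 0 < 8 / eps by rewrite divr_gt0 ?ltr0n.
  have id : 0 < delta^-1 by rewrite invr_gt0.
  have lt_n : 8 / eps + delta^-1 <= n.
    apply: le_trans (ltW (archi_boundP _)) _; first by rewrite addr_ge0 ?ltW.
    by rewrite ler_nat.
  split.
    by rewrite mulrC -ler_pdivrMr //; lra.
  by rewrite mulrC -ler_pdivrMr // div1r; lra.
have Lambda_ge : (1 / 8 - delta) * (#|V| ^_ 4)%:R <= (Lambda Hgraph G)%:R.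
  by move: lambda_ge; rewrite /lambda card_ord ler_pdivlMr // ltr0n ffact_gt0.
have fans_ge : (1 / 8 - eta ^+ 2 / 200) * n ^+ 4 <= fans R (adj G).
  apply: le_trans (le_trans Lambda_ge (Lambda_le_fans G R)).
  apply: le_trans (_ : (1 / 8 - delta) * (n ^+ 4 - 6 * n ^+ 3) <= _); last first.
    by rewrite ler_pM2l; [apply: ffact4_ge; exact: ltnW|lra].
  have n3 : 0 <= n ^+ 3 by rewrite exprn_ge0 // ltW.
  have : n ^+ 3 <= delta * n ^+ 4.
    by rewrite [n ^+ 4]exprS mulrA ler_peMl.
  have : 0 <= delta * n ^+ 3 by rewrite mulr_ge0 // ltW.
  by rewrite -/delta (_ : eta ^+ 2 / 200 = 2 * delta) /delta; [lra|field].
have [||x x_le] := exists_balanced_vertex (adj_sym G) _ _ fans_ge.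
- by rewrite ltW.
- exact: leq_trans n_ge4.
apply: le_trans (edit_dist_le G x R) _; rewrite -/n.
have neg_ge0 : 0 <= neg_sum R (adj G) x.
  by do 2 (apply: sumr_ge0 => ? _); exact: ler0n.
move: x_le neg_ge0; rewrite -/n; set D := sg_deg _ _ _; set m := neg_sum _ _ _.
move=> x_le m_ge0; have n2_gt0 : 0 < n ^+ 2 by rewrite exprn_gt0.
have m_le : m <= eps / 4 * n ^+ 2.
  have : eta * n ^+ 2 <= eps / 14 * n ^+ 2 by rewrite ler_pM2r.
  by have := sqr_ge0 D; lra.
have D_le : `|D| <= eps / 2 * n.
  have rhs_ge0 : 0 <= eps / 2 * n.
    by rewrite !mulr_ge0 ?invr_ge0 ?ler0n //; exact: ltW.
  rewrite -ler_sqr ?nnegrE ?normr_ge0 //.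
  rewrite real_normK ?num_real // exprMn expr_div_n.
  have : eta * n ^+ 2 <= eps ^+ 2 / 14 * n ^+ 2 by rewrite ler_pM2r.
  by have := mulr_ge0 (sqr_ge0 eps) (ltW n2_gt0); lra.
have nD_le : n * `|D| <= n * (eps / 2 * n) by rewrite ler_pM2l.
have n_le : n * 8 <= n * (eps * n) by rewrite ler_pM2l.
(* The three contributions are eps/4, eps/2 and eps/8 times n^2. *)
by lra.
Qed.
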